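(* There is an algorithm that, given an abstract network $(E, \mathcal{P})$ via a membership oracle and a vector $\gamma \in \mathbb{R}_+^E$, computes $P \in \mathcal{P}$ minimizing $\sum_{e \in P} \gamma_e$ in time $\mathcal{O}(|E|^2 \cdot T_{\mathcal{P}})$, where $T_{\mathcal{P}}$ denotes the time for one call to the membership oracle for $\mathcal{P}$.
   Context: An abstract network is a pair $(E,\mathcal{P})$ with $E$ a finite set (given explicitly) and $\mathcal{P} \subseteq 2^E$, where each $P \in \mathcal{P}$ carries a linear order $\preceq_P$ of its elements, such that for all $P, Q \in \mathcal{P}$ and all $e \in P \cap Q$ there exists $R \in \mathcal{P}$ with $R \subseteq \{p \in P : p \preceq_P e\} \cup \{q \in Q : e \preceq_Q q\}$. A membership oracle for $\mathcal{P}$, given $F \subseteq E$, either returns some $P \in \mathcal{P}$ with $P \subseteq F$ together with its order $\preceq_P$, or certifies that no such $P$ exists. *)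

(* Defs.v *)
From mathcomp Require Import all_boot all_order all_algebra.
From mathcomp Require Import reals.

Set Implicit Arguments.
Unset Strict Implicit.
Unset Printing Implicit Defensive.


(* [path_le P] is only meaningful, and only constrained, on the elements of a
   member [P] of [paths]. *)
Record abstract_network (E : finType) := AbstractNetwork {
  paths : {set {set E}};
  path_le : {set E} -> rel E;
  path_le_refl : forall P, P \in paths -> {in P, reflexive (path_le P)};
  path_le_anti : forall P, P \in paths -> {in P &, antisymmetric (path_le P)};
  path_le_trans : forall P, P \in paths -> {in P & &, transitive (path_le P)};
  path_le_total : forall P, P \in paths -> {in P &, total (path_le P)};
  path_switch : forall (P Q : {set E}) (e : E),
    P \in paths -> Q \in paths -> e \in P -> e \in Q ->
    exists2 R, R \in paths &
      R \subset [set p in P | path_le P p e] :|: [set q in Q | path_le Q e q]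
}.

Definition min_weight_path (R : realType) (E : finType)
    (N : abstract_network E) (gamma : E -> R) (P : {set E}) : Prop :=
  P \in paths N /\
  forall Q, Q \in paths N ->
    (\sum_(e in P) gamma e <= \sum_(e in Q) gamma e)%R.

Definition enumerates (E : finType) (P : {set E}) (s : seq E) : Prop :=
  uniq s /\ s =i P.

(* A path is returned together with its order by listing its elements in
   increasing order. *)
Definition membership_oracle (E : finType) (N : abstract_network E)
    (O : {set E} -> option (seq E)) : Prop :=
  forall F : {set E},
    match O F with
    | Some s => exists P : {set E},
        [/\ P \in paths N, P \subset F, enumerates P s & sorted (path_le N P) s]
    | None => forall P, P \in paths N -> ~~ (P \subset F)
    end.

(* The memory consists of arrays of natural numbers and arrays of reals. Array
   names are constants of the program, whereas indices are computed; a scalar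
   variable is cell 0 of an array. Arithmetic is additive: there is neither
   multiplication nor rounding, and 0 is the only real constant, so that unit
   costs are not abused and programs do not depend on the field of reals. *)
Inductive nexp :=
  | NConst of nat
  | NGet of nat & nexp
  | NAdd of nexp & nexp
  | NSub of nexp & nexp.

Inductive rexp :=
  | RZero
  | RGet of nat & nexp
  | RAdd of rexp & rexp
  | RSub of rexp & rexp.

Inductive bexp :=
  | NLe of nexp & nexp
  | RLe of rexp & rexp
  | BNot of bexp
  | BAnd of bexp & bexp.

Inductive cmd :=
  | Skip
  | NSet of nat & nexp & nexp  (* array, index, value *)
  | RSet of nat & nexp & rexp  (* array, index, value *)
  | Query of nat & nat         (* array with the query, array for the answer *)
  | Seq of cmd & cmd
  | If of bexp & cmd & cmd
  | While of bexp & cmd.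

Record state (R : realType) := State {
  nats : nat -> nat -> nat;
  rls : nat -> nat -> R
}.

Definition update (T : Type) (m : nat -> nat -> T) (a i : nat) (v : T) :=
  fun b j => if (b == a) && (j == i) then v else m b j.

Fixpoint neval (R : realType) (st : state R) (x : nexp) : nat :=
  match x with
  | NConst n => n
  | NGet a i => nats st a (neval st i)
  | NAdd x1 x2 => neval st x1 + neval st x2
  | NSub x1 x2 => neval st x1 - neval st x2
  end.

Fixpoint reval (R : realType) (st : state R) (x : rexp) : R :=
  match x with
  | RZero => 0%R
  | RGet a i => rls st a (neval st i)
  | RAdd x1 x2 => (reval st x1 + reval st x2)%R
  | RSub x1 x2 => (reval st x1 - reval st x2)%R
  end.

Fixpoint beval (R : realType) (st : state R) (x : bexp) : bool :=
  match x with
  | NLe x1 x2 => neval st x1 <= neval st x2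
  | RLe x1 x2 => (reval st x1 <= reval st x2)%R
  | BNot b => ~~ beval st b
  | BAnd b1 b2 => beval st b1 && beval st b2
  end.

(* The ground set is given explicitly: the element [e] is represented by its
   index [enum_rank e] in the enumeration of [E]. *)
Definition query_set (E : finType) (m : nat -> nat) : {set E} :=
  [set e : E | m (enum_rank e) != 0].

Definition encode_answer (E : finType) (o : option (seq E)) : seq nat :=
  match o with
  | Some s => (size s).+1 :: [seq nat_of_ord (enum_rank e) | e <- s]
  | None => [:: 0]
  end.

Definition write_seq (m : nat -> nat -> nat) (a : nat) (w : seq nat) :=
  fun b j => if b == a then nth (m b j) w j else m b j.

(* [exec O T c st st' t]: started in [st], the command [c] halts in [st'] after
   time [t], where a call to the oracle [O] takes time [T]. The expressions in
   a program have constant size, hence each assignment or test takes time 1. *)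
Inductive exec (R : realType) (E : finType) (O : {set E} -> option (seq E))
    (T : nat) : cmd -> state R -> state R -> nat -> Prop :=
  | exec_skip st : exec O T Skip st st 1
  | exec_nset a i x st :
      exec O T (NSet a i x) st
        (State (update (nats st) a (neval st i) (neval st x)) (rls st)) 1
  | exec_rset a i x st :
      exec O T (RSet a i x) st
        (State (nats st) (update (rls st) a (neval st i) (reval st x))) 1
  | exec_query q a st :
      exec O T (Query q a) st
        (State (write_seq (nats st) a
                  (encode_answer (O (query_set E (nats st q))))) (rls st)) T
  | exec_seq c1 c2 st1 st2 st3 t1 t2 :
      exec O T c1 st1 st2 t1 -> exec O T c2 st2 st3 t2 ->
      exec O T (Seq c1 c2) st1 st3 (t1 + t2)
  | exec_if b c1 c2 st st' t :
      exec O T (if beval st b then c1 else c2) st st' t ->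
      exec O T (If b c1 c2) st st' t.+1
  | exec_while_end b c st :
      ~~ beval st b -> exec O T (While b c) st st 1
  | exec_while_loop b c st1 st2 st3 t1 t2 :
      beval st1 b -> exec O T c st1 st2 t1 -> exec O T (While b c) st2 st3 t2 ->
      exec O T (While b c) st1 st3 (t1 + t2).+1.

Lemma exec_deterministic (R : realType) (E : finType)
    (O : {set E} -> option (seq E)) (T : nat) (c : cmd)
    (st st1 st2 : state R) (t1 t2 : nat) :
  exec O T c st st1 t1 -> exec O T c st st2 t2 -> st1 = st2 /\ t1 = t2.
Proof.
move=> H; elim: H st2 t2 => {c st st1 t1}.
- by move=> st st2 t2 H; inversion H.
- by move=> a i x st st2 t2 H; inversion H.
- by move=> a i x st st2 t2 H; inversion H.
- by move=> q a st st2 t2 H; inversion H.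
- move=> c1 c2 s1 s2 s3 t1 t2 _ IH1 _ IH2 st t H.
  inversion H as [| | | | ? ? ? ? ? ? ? K1 K2 | | |]; subst.
  by case: (IH1 _ _ K1) => ? ?; subst; case: (IH2 _ _ K2) => ? ?; subst.
- move=> b c1 c2 st st' t _ IH st2 t2 H.
  inversion H as [| | | | | ? ? ? ? ? ? K | |]; subst.
  by case: (IH _ _ K) => ? ?; subst.
- move=> b c st Hb st2 t2 H.
  inversion H as [| | | | | | | ? ? ? ? ? ? ? K]; subst => //.
  by rewrite K in Hb.
- move=> b c s1 s2 s3 t1 t2 Hb _ IH1 _ IH2 st t H.
  inversion H as [| | | | | | ? ? ? K | ? ? ? ? ? ? ? _ K1 K2]; subst.
    by rewrite Hb in K.
  by case: (IH1 _ _ K1) => ? ?; subst; case: (IH2 _ _ K2) => ? ?; subst.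
Qed.

(* Input: |E| in cell 0 of array 0 of naturals, gamma in array 0 of reals; all
   other cells are 0. *)
Definition initial_state (R : realType) (E : finType) (gamma : E -> R) :
    state R :=
  State (update (fun _ _ => 0) 0 0 #|E|)
        (fun a i => if a == 0 then nth 0%R [seq gamma e | e <- enum E] i else 0%R).

(* Output: array 1 of naturals, in the format of the oracle answers. *)
Definition outputs (R : realType) (E : finType) (st : state R)
    (o : option (seq E)) : Prop :=
  forall i, i < size (encode_answer o) ->
    nats st 1 i = nth 0 (encode_answer o) i.

(* If there is no path at all, then there is no minimizer and the program has
   to report this. *)
Definition solves_min_path (R : realType) (E : finType)
    (N : abstract_network E) (gamma : E -> R) (o : option (seq E)) : Prop :=
  match o with
  | Some s => exists2 P, min_weight_path N gamma P & enumerates P s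
  | None => paths N = set0
  end.

(* Main.v *)
Require Import Defs.
From mathcomp Require Import all_boot all_order all_algebra.
From mathcomp Require Import reals zify.

(* The program packs cuts into [gamma] greedily, as Dijkstra's algorithm does.
   It maintains a frontier and the set of the exhausted elements, which have
   left it. A query with the complement of the frontier either returns a path,
   whose first element that is not exhausted then enters the frontier together
   with the prefix of the path that ends there, or shows that the frontier is a
   cut. In the latter case the cut receives the largest weight that the
   residual capacities allow, and an element without residual capacity leaves
   the frontier. After at most [2 |E| + 1] queries, this finds a path of
   exhausted elements.

   Such a path is optimal if it crosses every cut exactly once. To achieve
   this, treat the cuts from the last to the first: switch, at the last element
   [e] of the path in the cut, to the stored prefix of [e]. Since this prefix
   had left the frontier before [e] entered it, it contains no element other
   than [e] of this cut or of a later one. *)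

Set Implicit Arguments.
Unset Strict Implicit.
Unset Printing Implicit Defensive.
Import Order.TTheory GRing.Theory Num.Theory.

Definition optimal_index (n : nat) (p : pred nat) (r : rel nat)
    (f : nat) : Prop :=
  if f is i.+1 then [/\ i < n, p i & forall j, j < n -> p j -> ~~ r j i]
  else forall j, j < n -> ~~ p j.

Lemma optimal_index_succ (n : nat) (p : pred nat) (r : rel nat) (f : nat) :
  irreflexive r -> transitive r -> optimal_index n p r f ->
  optimal_index n.+1 p r
    (if p n && ~~ ((0 < f) && ~~ r n (f - 1)) then n.+1 else f).
Proof.
move=> r_irr r_trans; case: f => [|i] /=.
  rewrite andbT => none; case: ifP => [pn|/negbT npn].
    split=> // j; rewrite ltnS leq_eqVlt => /orP[/eqP ->|/none/negbTE -> //].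
    by rewrite r_irr.
  by move=> j; rewrite ltnS leq_eqVlt => /orP[/eqP ->|/none].
rewrite subn1 negbK /= => -[lt_i pi best].
case: ifP => [/andP[pn r_ni]|not_better].
  split=> // j; rewrite ltnS leq_eqVlt => /orP[/eqP ->|lt_j pj];
    first by rewrite r_irr.
  by apply: contra (best j lt_j pj) => r_jn; apply: r_trans r_ni.
split=> //; first exact: leqW.
move=> j; rewrite ltnS leq_eqVlt => /orP[/eqP ->|]; last exact: best.
by case: (p n) not_better => //= ->.
Qed.

Lemma index_onto (A : eqType) (s : seq A) (i : nat) :
  uniq s -> i < size s -> exists2 x, x \in s & index x s = i.
Proof.
case: s => [//|x s] uniq_s lt_i.
by exists (nth x (x :: s) i); [exact: mem_nth|exact: index_uniq].
Qed.

Definition optimal_entry (A : eqType) (s : seq A) (p : pred A) (r : rel nat)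
    (f : nat) : Prop :=
  if f is i.+1 then
    exists e, [/\ e \in s, i = index e s, p e &
      {in s, forall x, p x -> ~~ r (index x s) i}]
  else {in s, forall x, ~~ p x}.

Section IndexedSets.
Variable E : finType.
Implicit Types (s : seq E) (e x : E).

Definition indexed s (p : pred nat) : {set E} := [set x in s | p (index x s)].
Definition prefix_to s e : {set E} := indexed s (leq^~ (index e s)).
Definition suffix_from s e : {set E} := indexed s (leq (index e s)).

Lemma indexed_ltn0 s (p : pred nat) :
  indexed s (fun i => (i < 0) && p i) = set0.
Proof. by apply/setP => x; rewrite !inE andbF. Qed.

Lemma indexed_ltnS s (p : pred nat) x :
  x \in s ->
  indexed s (fun i => (i < (index x s).+1) && p i) =
    (if p (index x s) then [set x] else set0) :|:
    indexed s (fun i => (i < index x s) && p i).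
Proof.
move=> xs; apply/setP => y; rewrite in_setU !inE ltnS leq_eqVlt.
have [->|y_neq] := eqVneq y x.
  by rewrite xs eqxx ltnn /= orbF; case: ifP; rewrite !inE ?eqxx.
have -> : (y \in if p (index x s) then [set x] else set0) = false.
  by case: ifP; rewrite !inE ?(negbTE y_neq).
apply: andb_id2l => ys; rewrite (_ : (index y s == index x s) = false) //.
by apply: contraNF y_neq => /eqP/(index_inj x ys xs) ->.
Qed.

Lemma indexed_ltn_size s (p : pred nat) :
  indexed s (fun i => (i < size s) && p i) = indexed s p.
Proof.
by apply/setP => x; rewrite !inE; apply: andb_id2l => xs; rewrite index_mem xs.
Qed.

Lemma uniq_size_le_card s : uniq s -> size s <= #|E|.
Proof. by move=> uniq_s; rewrite -(card_uniqP uniq_s) max_card. Qed.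

End IndexedSets.

Section Paths.
Variables (E : finType) (N : abstract_network E).
Implicit Types (s u : seq E) (e x y : E) (F P : {set E}).

Definition listed_path s : Prop :=
  [/\ [set x in s] \in paths N, uniq s &
      sorted (Defs.path_le N [set x in s]) s].

Lemma listed_pathP P s :
  P \in paths N -> enumerates P s -> sorted (Defs.path_le N P) s ->
  listed_path s /\ [set x in s] = P.
Proof.
move=> pathP [uniq_s sP] sorted_s.
have sE : [set x in s] = P by apply/setP => x; rewrite inE sP.
by rewrite /listed_path sE.
Qed.

Lemma path_le_index s x y :
  listed_path s -> x \in s -> y \in s -> Defs.path_le N [set x in s] x y ->
  index x s <= index y s.
Proof.
move=> [path_s _ sorted_s] xs ys le_xy; rewrite leqNgt;
  apply/negP => lt_yx.
have all_s : all (mem [set x in s]) s by apply/allP => z; rewrite !inE.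
have le_yx : Defs.path_le N [set x in s] y x.
  rewrite -[y](nth_index y ys) -[x](nth_index y xs).
  by rewrite (sorted_ltn_nth_in (path_le_trans path_s) y all_s) ?inE ?index_mem.
have eq_xy : x = y by apply: (path_le_anti path_s); rewrite ?inE // le_xy.
by rewrite eq_xy ltnn in lt_yx.
Qed.

Lemma listed_path_switch s u e :
  listed_path s -> listed_path u -> e \in s -> e \in u ->
  exists2 P, P \in paths N & P \subset prefix_to s e :|: suffix_from u e.
Proof.
move=> list_s list_u es eu.
have [path_s _ _] := list_s; have [path_u _ _] := list_u.
have [||P pathP subP] := path_switch path_s path_u (e := e); rewrite ?inE //.
exists P => //; apply: subset_trans subP _; apply/subsetP => x.
rewrite !inE => /orP[/andP[xs le_xe]|/andP[xu le_ex]]; apply/orP; [left|right].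
  by rewrite xs path_le_index.
by rewrite xu path_le_index.
Qed.

Section Oracle.
Variable O : {set E} -> option (seq E).
Hypothesis oracleO : membership_oracle N O.

Lemma oracle_some F s : O F = Some s -> listed_path s /\ [set x in s] \subset F.
Proof.
move=> O_F; have := oracleO F; rewrite O_F => -[P [pathP PF enum_s sorted_s]].
by have [list_s ->] := listed_pathP pathP enum_s sorted_s.
Qed.

Lemma oracle_none F P : O (~: F) = None -> P \in paths N -> P :&: F != set0.
Proof.
move=> O_F; have := oracleO (~: F); rewrite O_F => noP pathP.
by rewrite setI_eq0 disjoints_subset noP.
Qed.

End Oracle.
End Paths.

Lemma cut_packing_weight_le (R : numDomainType) (E : finType) (I : eqType)
    (r : seq I) (C : I -> {set E}) (w : I -> R) (gamma : E -> R)
    (P Q : {set E}) :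
  {in r, forall i, 0 <= w i}%R ->
  {in r, forall i, #|P :&: C i| <= #|Q :&: C i|} ->
  {in P, forall e, gamma e <= \sum_(i <- r | e \in C i) w i}%R ->
  {in Q, forall e, \sum_(i <- r | e \in C i) w i <= gamma e}%R ->
  (\sum_(e in P) gamma e <= \sum_(e in Q) gamma e)%R.
Proof.
move=> w_ge0 crossings gammaP gammaQ.
have loadE (S : {set E}) : (\sum_(e in S) \sum_(i <- r | e \in C i) w i =
    \sum_(i <- r) w i *+ #|S :&: C i|)%R.
  rewrite (exchange_big_dep xpredT) //=; apply: eq_bigr => i _.
  by rewrite -sumr_const; apply: eq_bigl => e; rewrite inE.
apply: (le_trans (ler_sum _ gammaP)); apply: (le_trans _ (ler_sum _ gammaQ)).
rewrite !loadE big_seq [leRHS]big_seq; apply: ler_sum => i ir.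
by rewrite ler_wpMn2l ?w_ge0 ?crossings.
Qed.

Section CutPacking.
Variables (R : numDomainType) (E : finType) (N : abstract_network E).
Variable gamma : E -> R.
Hypothesis gamma_ge0 : forall e, (0 <= gamma e)%R.
Implicit Types (e f m x : E) (i : nat) (s u : seq E) (B P Q : {set E}).

(* Rounds are numbered from 1, so that [entered_at h e = 0] and [left_at h e =
   0] mean that [e] has not yet entered, respectively left, the frontier. An
   element that leaves it in round [i] still belongs to the cut of that round.
   The set [access h e] is the prefix, up to [e], of the path that made [e]
   enter, and [due h e] is the value of [clock h], the total weight of the cuts
   so far, at which [e] will be exhausted. *)
Record cut_history := CutHistory {
  entered_at : E -> nat;
  left_at : E -> nat;
  access : E -> {set E};
  due : E -> R;
  rounds : nat;
  clock : R;
  cut_weight : nat -> R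
}.
Implicit Type h : cut_history.

Definition discovered h : {set E} := [set e | 0 < entered_at h e].
Definition exhausted h : {set E} := [set e | 0 < left_at h e].
Definition frontier h : {set E} := discovered h :\: exhausted h.

Definition cut h i : {set E} := [set e in discovered h |
  (entered_at h e <= i) && ((e \notin exhausted h) || (i <= left_at h e))].

Definition residual h e : R :=
  if e \notin discovered h then gamma e
  else if e \in frontier h then (due h e - clock h)%R else 0%R.

Definition load h e : R :=
  (\sum_(1 <= i < (rounds h).+1 | e \in cut h i) cut_weight h i)%R.

Record cut_packing h : Prop := CutPacking {
  entered_at_le : forall e, entered_at h e <= (rounds h).+1;
  left_at_le : forall e, left_at h e <= rounds h;
  exhausted_discovered : exhausted h \subset discovered h;
  rounds_exhausted : rounds h = #|exhausted h|;
  cut_meets : forall i P, 0 < i <= rounds h -> P \in paths N ->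
    P :&: cut h i != set0;
  access_switch : forall e u, e \in discovered h -> listed_path N u ->
    e \in u ->
    exists2 Q, Q \in paths N & Q \subset access h e :|: suffix_from u e;
  access_left_before : forall e f, e \in discovered h -> f \in access h e ->
    f != e -> 0 < left_at h f < entered_at h e;
  cut_weight_ge0 : forall i, (0 <= cut_weight h i)%R;
  residual_ge0 : forall e, (0 <= residual h e)%R;
  residual_load : forall e, gamma e = (residual h e + load h e)%R
}.

Definition empty_history : cut_history :=
  CutHistory (fun=> 0) (fun=> 0) (fun=> set0) (fun=> 0%R) 0 0%R (fun=> 0%R).

Definition enter h e B : cut_history :=
  CutHistory [eta entered_at h with e |-> (rounds h).+1] (left_at h)
    [eta access h with e |-> B] [eta due h with e |-> (clock h + gamma e)%R]
    (rounds h) (clock h) (cut_weight h).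

Definition leave h m : cut_history :=
  CutHistory (entered_at h) [eta left_at h with m |-> (rounds h).+1]
    (access h) (due h) (rounds h).+1 (due h m)
    [eta cut_weight h with (rounds h).+1 |-> (due h m - clock h)%R].

Lemma discovered_empty : discovered empty_history = set0.
Proof. by apply/setP => e; rewrite !inE. Qed.

Lemma exhausted_empty : exhausted empty_history = set0.
Proof. by apply/setP => e; rewrite !inE. Qed.

Lemma cut_packing_empty : cut_packing empty_history.
Proof.
split=> //=.
- by rewrite exhausted_empty cards0.
- by case.
- by move=> e u; rewrite discovered_empty inE.
- by move=> e f; rewrite discovered_empty inE.
- by move=> e; rewrite /residual discovered_empty inE /=.
- by move=> e; rewrite /residual /load discovered_empty inE /= big_geq ?addr0.
Qed.

Lemma discovered_enter h e B : discovered (enter h e B) = e |: discovered h.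
Proof. by apply/setP => x; rewrite !inE /=; case: eqP. Qed.

Lemma frontier_enter h e B :
  cut_packing h -> e \notin discovered h ->
  frontier (enter h e B) = e |: frontier h.
Proof.
move=> pack_h e_new; have e_kept : e \notin exhausted h.
  by apply: contra e_new => /(subsetP (exhausted_discovered pack_h)).
rewrite /frontier discovered_enter setDUl; congr (_ :|: _).
by apply/setDidPl; rewrite disjoints1.
Qed.

Lemma cut_enter h e B i :
  e \notin discovered h -> i <= rounds h -> cut (enter h e B) i = cut h i.
Proof.
rewrite inE -eqn0Ngt => /eqP e0 le_i; apply/setP => x; rewrite !inE /=.
by case: eqP => // ->; rewrite e0 [_ < i]ltnNge le_i.
Qed.

Lemma residual_enter h e B x :
  cut_packing h -> e \notin discovered h ->
  residual (enter h e B) x = residual h x.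
Proof.
move=> pack_h e_new.
rewrite /residual frontier_enter // discovered_enter !in_setU1 /=.
by case: (x =P e) => //= ->; rewrite e_new addrC addKr.
Qed.

Lemma load_enter h e B x :
  e \notin discovered h -> load (enter h e B) x = load h x.
Proof.
move=> e_new; rewrite /load [LHS]big_nat_cond [RHS]big_nat_cond;
  apply: eq_bigl => i.
by apply: andb_id2l => /andP[_ lt_i]; rewrite cut_enter.
Qed.

Lemma cut_packing_enter h s e :
  cut_packing h -> listed_path N s -> e \in s -> e \notin discovered h ->
  {in s, forall x, index x s < index e s -> x \in exhausted h} ->
  cut_packing (enter h e (prefix_to s e)).
Proof.
move=> pack_h list_s es e_new before_e; split=> //=.
- by move=> x; case: ifP => // _; apply: entered_at_le.
- exact: left_at_le.
- by rewrite discovered_enter subsetU // (exhausted_discovered pack_h) orbT.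
- exact: rounds_exhausted.
- move=> i P /andP[i_gt0 le_i] pathP.
  by rewrite cut_enter // (cut_meets pack_h) // i_gt0.
- move=> x u; rewrite discovered_enter !inE;
    case: eqP => [-> _|_ x_old] list_u xu.
    exact: listed_path_switch.
  by apply: (access_switch pack_h) => //; rewrite inE.
- move=> x f; rewrite discovered_enter !inE; case: eqP => [-> _|_ x_old].
    rewrite inE => /andP[fs le_fe] f_neq_e;
      rewrite ltnS (left_at_le pack_h) andbT.
    suff: f \in exhausted h by rewrite inE.
    apply: before_e => //; rewrite ltn_neqAle le_fe andbT.
    by apply: contra f_neq_e => /eqP/index_inj->.
  by apply: (access_left_before pack_h); rewrite inE.
- exact: cut_weight_ge0.
- by move=> x; rewrite residual_enter // residual_ge0.
- by move=> x; rewrite residual_enter // load_enter // -(residual_load pack_h).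
Qed.

Lemma exhausted_leave h m : exhausted (leave h m) = m |: exhausted h.
Proof. by apply/setP => x; rewrite !inE /=; case: eqP. Qed.

Lemma frontier_leave h m : frontier (leave h m) = frontier h :\ m.
Proof. by rewrite /frontier exhausted_leave setUC setDDl. Qed.

Lemma cut_leave h m i :
  m \notin exhausted h -> i <= rounds h -> cut (leave h m) i = cut h i.
Proof.
rewrite inE -eqn0Ngt => /eqP m0 le_i; apply/setP => x; rewrite !inE /=.
by case: (x =P m) => // ->; rewrite m0 (leqW le_i).
Qed.

Lemma cut_leave_last h m :
  cut_packing h -> m \in frontier h ->
  cut (leave h m) (rounds h).+1 = frontier h.
Proof.
move=> pack_h; rewrite !inE => /andP[m_kept m_old]; apply/setP => x;
  rewrite !inE /=.
rewrite (entered_at_le pack_h); case: (x =P m) => [->|_].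
  by rewrite m_old m_kept leqnn.
by rewrite [rounds h < _]ltnNge (left_at_le pack_h) orbF andbC.
Qed.

Lemma residual_leave h m x :
  m \in frontier h ->
  residual h x = (residual (leave h m) x +
    if x \in frontier h then due h m - clock h else 0)%R.
Proof.
rewrite !inE => /andP[m_kept m_old]; rewrite /residual !inE /=.
case: (x =P m) => [->|_]; first by rewrite m_kept m_old /= add0r.
by case: (0 < entered_at h x); case: (0 < left_at h x);
  rewrite /= ?addr0 // addrA subrK.
Qed.

Lemma residual_leave_ge0 h m x :
  cut_packing h -> {in frontier h, forall e, due h m <= due h e}%R ->
  (0 <= residual (leave h m) x)%R.
Proof.
move=> pack_h min_m; have := residual_ge0 pack_h x.
rewrite /residual /frontier exhausted_leave.
rewrite !inE /=; case: ifP => // x_old; case: (x =P m) => //= _.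
by case: ifP => // x_kept _; rewrite subr_ge0 min_m // !inE x_kept.
Qed.

Lemma load_leave h m x :
  cut_packing h -> m \in frontier h ->
  load (leave h m) x =
    (load h x + if x \in frontier h then due h m - clock h else 0)%R.
Proof.
move=> pack_h m_front; have /setDP[_ m_kept] := m_front.
rewrite /load big_mkcond [in RHS]big_mkcond big_nat_recr //=.
rewrite cut_leave_last // eqxx.
congr (_ + _)%R; apply: eq_big_nat => i /andP[_ lt_i].
by rewrite cut_leave // ltn_eqF.
Qed.

Lemma cut_packing_leave h m :
  cut_packing h -> m \in frontier h ->
  {in frontier h, forall e, due h m <= due h e}%R ->
  (forall P, P \in paths N -> P :&: frontier h != set0) ->
  cut_packing (leave h m).
Proof.
move=> pack_h m_front min_m frontier_meets.
have /setDP[m_old m_kept] := m_front.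
split=> //=.
- by move=> x; apply/leqW/entered_at_le.
- by move=> x; case: ifP => // _; apply/leqW/left_at_le.
- by rewrite exhausted_leave subUset sub1set m_old exhausted_discovered.
- by rewrite exhausted_leave cardsU1 m_kept (rounds_exhausted pack_h).
- move=> i P /andP[i_gt0]; rewrite leq_eqVlt => /orP[/eqP ->|lt_i] pathP.
    by rewrite cut_leave_last // frontier_meets.
  by rewrite cut_leave // (cut_meets pack_h) // i_gt0.
- exact: (access_switch pack_h).
- move=> e f e_old f_acc f_neq_e.
  have := access_left_before pack_h e_old f_acc f_neq_e.
  by case: (f =P m) => // ->; move: m_kept; rewrite inE => /negbTE ->.
- move=> i; case: ifP => // _; last exact: cut_weight_ge0.
  by have := residual_ge0 pack_h m; rewrite /residual m_old m_front.
- by move=> x; apply: residual_leave_ge0.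
- move=> x; rewrite (residual_load pack_h) (residual_leave _ m_front).
  by rewrite load_leave // -addrA [X in (_ + X)%R]addrC.
Qed.

Lemma mem_cut_exhausted h i x :
  cut_packing h -> x \in exhausted h ->
  (x \in cut h i) = (entered_at h x <= i <= left_at h x).
Proof.
move=> pack_h x_exh.
by rewrite inE (subsetP (exhausted_discovered pack_h)) // x_exh.
Qed.

Definition crosses_once_after h i P : Prop :=
  forall j, i < j <= rounds h -> #|P :&: cut h j| <= 1.

Section Reroute.
Variables (h : cut_history) (i : nat) (u : seq E) (e : E) (Q : {set E}).
Hypotheses (pack_h : cut_packing h) (eu : e \in u) (e_cut : e \in cut h i.+1).
Hypothesis u_exhausted : [set x in u] \subset exhausted h.
Hypothesis last_e :
  {in u, forall x, x \in cut h i.+1 -> index x u <= index e u}.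
Hypothesis u_crosses_once : crosses_once_after h i.+1 [set x in u].
Hypothesis subQ : Q \subset access h e :|: suffix_from u e.

Lemma reroute_exhausted : Q \subset exhausted h.
Proof.
have /setIdP[e_old _] := e_cut; apply/subsetP => x /(subsetP subQ).
rewrite in_setU => /orP[x_acc|]; last first.
  by rewrite inE => /andP[xu _]; apply: (subsetP u_exhausted); rewrite inE.
have [->|x_neq_e] := eqVneq x e.
  by apply: (subsetP u_exhausted); rewrite inE.
by have /andP[] := access_left_before pack_h e_old x_acc x_neq_e; rewrite inE.
Qed.

(* The access set of [e] left the frontier before [e] entered it. *)
Lemma reroute_cut j :
  i < j -> Q :&: cut h j \subset suffix_from u e :&: cut h j.
Proof.
move=> lt_ij; have /setIdP[e_old /andP[le_e _]] := e_cut.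
apply/subsetP => x /setIP[xQ x_cut]; rewrite in_setI x_cut andbT.
have [x_acc|//] := setUP (subsetP subQ x xQ).
have [->|x_neq_e] := eqVneq x e; first by rewrite inE eu leqnn.
have /andP[_ lt_x] := access_left_before pack_h e_old x_acc x_neq_e.
have := subsetP reroute_exhausted x xQ => x_exh.
move: x_cut; rewrite mem_cut_exhausted // => /andP[_ le_j].
by have := leq_ltn_trans (leq_trans lt_ij le_j) (leq_trans lt_x le_e);
  rewrite ltnn.
Qed.

Lemma reroute_crosses_once : crosses_once_after h i Q.
Proof.
move=> j /andP[lt_ij le_j];
  apply: leq_trans (subset_leq_card (reroute_cut lt_ij)) _.
move: (lt_ij); rewrite leq_eqVlt => /orP[/eqP <-|lt_i1j].
  rewrite -(cards1 e) subset_leq_card //; apply/subsetP => x.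
  move=> /setIP[/setIdP[xu le_ex] x_cut]; rewrite inE;
    apply/eqP/(index_inj e xu eu)/eqP.
  by rewrite eqn_leq le_ex last_e.
apply: leq_trans (u_crosses_once (j := j) _); last by rewrite lt_i1j.
by apply/subset_leq_card/setSI/subsetP => x; rewrite !inE => /andP[].
Qed.

End Reroute.

Lemma crosses_once_optimal h P Q :
  cut_packing h -> P \in paths N -> P \subset exhausted h ->
  crosses_once_after h 0 P -> Q \in paths N ->
  (\sum_(e in P) gamma e <= \sum_(e in Q) gamma e)%R.
Proof.
move=> pack_h pathP P_exh P_once pathQ.
apply: (cut_packing_weight_le (r := index_iota 1 (rounds h).+1) (C := cut h)
  (w := cut_weight h)) => [i _|i|e eP|e _]; first exact: cut_weight_ge0.
- rewrite mem_index_iota => i_bounds; apply: leq_trans (P_once i i_bounds) _.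
  by rewrite card_gt0 (cut_meets pack_h).
- have e_exh := subsetP P_exh e eP; rewrite (residual_load pack_h) /residual.
  by rewrite (subsetP (exhausted_discovered pack_h)) // inE e_exh add0r.
- by rewrite [leRHS](residual_load pack_h) lerDr residual_ge0.
Qed.

End CutPacking.

Local Notation rk e := (nat_of_ord (enum_rank e)) (only parsing).

Lemma enum_rank_eq (E : finType) (x y : E) : (rk x == rk y) = (x == y).
Proof. by rewrite val_eqE (inj_eq enum_rank_inj). Qed.

Section Machine.
Variables (R : realType) (E : finType).
Variables (O : {set E} -> option (seq E)) (T : nat).
Implicit Types (st : state R) (c : cmd) (b : bexp) (Q : state R -> Prop).
Implicit Types (a i j k n : nat) (l : seq nat).

Definition halts c st k Q : Prop :=
  exists st' t, [/\ exec O T c st st' t, t <= k & Q st'].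

Definition set_nat st a i v : state R :=
  State (update (nats st) a i v) (rls st).
Definition set_real st a i v : state R :=
  State (nats st) (update (rls st) a i v).

Lemma halts_weaken c st k k' Q Q' :
  halts c st k Q -> k <= k' -> (forall st', Q st' -> Q' st') ->
  halts c st k' Q'.
Proof.
move=> [st' [t [run le_tk Qst']]] le_kk' QQ'; exists st', t; split=> //.
  exact: leq_trans le_kk'.
exact: QQ'.
Qed.

Lemma halts_skip st k Q : 0 < k -> Q st -> halts Skip st k Q.
Proof. by move=> k_gt0 Qst; exists st, 1; split=> //; constructor. Qed.

Lemma halts_nset a (i x : nexp) st k Q :
  0 < k -> Q (set_nat st a (neval st i) (neval st x)) ->
  halts (NSet a i x) st k Q.
Proof.
by move=> k_gt0 Qst; eexists; exists 1; split=> //;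
  first exact: exec_nset.
Qed.

Lemma halts_rset a (i : nexp) (x : rexp) st k Q :
  0 < k -> Q (set_real st a (neval st i) (reval st x)) ->
  halts (RSet a i x) st k Q.
Proof.
by move=> k_gt0 Qst; eexists; exists 1; split=> //;
  first exact: exec_rset.
Qed.

Lemma halts_seq c1 c2 st k1 k2 k Q :
  halts c1 st k1 (fun st' => halts c2 st' k2 Q) -> k1 + k2 <= k ->
  halts (Seq c1 c2) st k Q.
Proof.
move=> [st1 [t1 [run1 le1 [st2 [t2 [run2 le2 Qst2]]]]]] le_k.
exists st2, (t1 + t2); split=> //; first exact: exec_seq run1 run2.
exact: leq_trans (leq_add le1 le2) le_k.
Qed.

Lemma halts_nset_seq a (i x : nexp) c st k Q :
  halts c (set_nat st a (neval st i) (neval st x)) k Q ->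
  halts (Seq (NSet a i x) c) st k.+1 Q.
Proof.
by move=> run; apply: (halts_seq (k1 := 1) (k2 := k)) => //;
  apply: halts_nset.
Qed.

Lemma halts_rset_seq a (i : nexp) (x : rexp) c st k Q :
  halts c (set_real st a (neval st i) (reval st x)) k Q ->
  halts (Seq (RSet a i x) c) st k.+1 Q.
Proof.
by move=> run; apply: (halts_seq (k1 := 1) (k2 := k)) => //;
  apply: halts_rset.
Qed.

Lemma halts_if b c1 c2 st k Q :
  halts (if beval st b then c1 else c2) st k Q -> halts (If b c1 c2) st k.+1 Q.
Proof.
move=> [st' [t [run le_tk Qst']]]; exists st', t.+1; split=> //.
exact: exec_if.
Qed.

Lemma halts_while b c k n st (Inv : nat -> state R -> Prop) :
  (forall st', Inv 0 st' -> ~~ beval st' b) ->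
  (forall i st', Inv i.+1 st' -> beval st' b -> halts c st' k (Inv i)) ->
  Inv n st ->
  halts (While b c) st (n * k.+1).+1
    (fun st' => ~~ beval st' b /\ exists i, Inv i st').
Proof.
move=> exit body; elim: n st => [|n IHn] st inv.
  exists st, 1; split=> //; first exact/exec_while_end/exit.
  by split; [exact: exit|exists 0].
have [guard|stop] := boolP (beval st b); last first.
  by exists st, 1; split=> //; [exact: exec_while_end|split=> //; exists n.+1].
have [st1 [t1 [run1 le1 inv1]]] := body n st inv guard.
have [st2 [t2 [run2 le2 Qst2]]] := IHn st1 inv1.
exists st2, (t1 + t2).+1; split=> //; first exact: exec_while_loop run1 run2.
by rewrite ltnS mulSn addSnnS leq_add.
Qed.

Definition agree_off l st st' : Prop :=
  (forall a, a \notin l -> nats st' a =1 nats st a) /\ rls st' = rls st.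

Lemma agree_off_refl l st : agree_off l st st.
Proof. by []. Qed.

Lemma agree_off_set l st st' a i v :
  a \in l -> agree_off l st st' -> agree_off l st (set_nat st' a i v).
Proof.
move=> al [agree_nats agree_rls]; split=> // b bl j; rewrite /= /update.
by case: eqP bl al => [-> /negbTE ->|_ bl _] //=; apply: agree_nats.
Qed.

Lemma agree_off_set1 st a i v : agree_off [:: a] st (set_nat st a i v).
Proof. by apply: agree_off_set; [rewrite inE|apply: agree_off_refl]. Qed.

Lemma agree_off_trans l st1 st2 st3 :
  agree_off l st1 st2 -> agree_off l st2 st3 -> agree_off l st1 st3.
Proof.
move=> [nats12 rls12] [nats23 rls23]; split=> [a al j|]; last by rewrite rls23.
by rewrite nats23 ?nats12.
Qed.

Definition cell0 a : nexp := NGet a (NConst 0).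

Definition for_loop a (bound : nexp) c : cmd :=
  Seq (NSet a (NConst 0) (NConst 0))
    (While (BNot (NLe bound (cell0 a)))
       (Seq c (NSet a (NConst 0) (NAdd (cell0 a) (NConst 1))))).

Lemma halts_for l a (bound : nexp) c n k st0 st (Inv : nat -> state R -> Prop) :
  a \in l -> agree_off l st0 st ->
  (forall st', agree_off l st0 st' -> neval st' bound = n) ->
  (forall i j st', Inv i st' -> Inv i (set_nat st' a 0 j)) ->
  Inv 0 st ->
  (forall i st', i < n -> agree_off l st0 st' ->
     nats st' a 0 = i -> Inv i st' ->
     halts c st' k (fun st'' =>
       [/\ agree_off l st0 st'', nats st'' a 0 = i & Inv i.+1 st''])) ->
  halts (for_loop a bound c) st (n * k.+2 + 2)
    (fun st' => agree_off l st0 st' /\ Inv n st').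
Proof.
move=> al agree0 boundE Inv_counter Inv0 body; rewrite addn2.
apply: halts_nset_seq => /=.
pose WInv r st' :=
  [/\ r <= n, agree_off l st0 st', nats st' a 0 = n - r & Inv (n - r) st'].
have cond r st' :
    WInv r st' -> beval st' (BNot (NLe bound (cell0 a))) = (0 < r).
  by move=> [le_r agree a_r _]; rewrite /= a_r boundE // -ltnNge; lia.
apply: halts_weaken
  (halts_while (k := k.+1) (n := n) (Inv := WInv) _ _ _) _ _ => //.
- by move=> st' /cond ->.
- move=> r st' [lt_r agree a_r inv] _; apply: (halts_seq (k1 := k) (k2 := 1));
    last by rewrite addn1.
  have lt_i : n - r.+1 < n by rewrite subnSK ?leq_subr.
  apply: halts_weaken (body _ _ lt_i agree a_r inv) _ _ => //
    st'' [agree'' a'' inv''].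
  apply: halts_nset => //=; split; first exact: ltnW.
  + exact: agree_off_set.
  + by rewrite /= /update !eqxx a'' addn1 subnSK.
  + by apply: (Inv_counter (n - r)); rewrite -subnSK.
- rewrite /WInv subnn; split=> //; first exact: agree_off_set.
  + by rewrite /= /update !eqxx.
  + exact: Inv_counter.
- move=> st' [stop [r winv]]; move: stop;
    rewrite (cond _ _ winv) -eqn0Ngt => /eqP r0.
  by case: winv; rewrite r0 subn0.
Qed.

(* In [a_query], [a_entered], [a_left], [a_row], [r_gamma] and [r_due], cell
   [rk e] belongs to the element [e]. The access set of [e] is a block of [#|E|]
   cells of [a_access] that starts at the address in [a_row]; [a_free] is the
   first free address. A search sets [a_found] to the position of its result
   plus one, or to 0 if there is none. *)
Local Notation a_size := 0 (only parsing).
Local Notation a_answer := 1 (only parsing).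
Local Notation a_query := 2 (only parsing).
Local Notation a_entered := 3 (only parsing).
Local Notation a_left := 4 (only parsing).
Local Notation a_row := 5 (only parsing).
Local Notation a_access := 6 (only parsing).
Local Notation a_free := 7 (only parsing).
Local Notation a_rounds := 8 (only parsing).
Local Notation a_cut := 9 (only parsing).
Local Notation a_index := 10 (only parsing).
Local Notation a_found := 11 (only parsing).

Local Notation r_gamma := 0 (only parsing).
Local Notation r_due := 1 (only parsing).
Local Notation r_clock := 2 (only parsing).

Lemma halts_query q st Q :
  (forall st', agree_off [:: a_answer] st st' ->
     outputs st' (O (query_set E (nats st q))) -> Q st') ->
  halts (Query q a_answer) st T Q.
Proof.
move=> Qst; eexists; exists T; split=> //; first exact: exec_query.
apply: Qst => [|i lt_i].
  by split=> // a; rewrite inE /= /write_seq => /negbTE -> j.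
by rewrite /= /write_seq eqxx; apply: set_nth_default.
Qed.

Lemma outputs_agree_off l st st' (o : option (seq E)) :
  agree_off l st st' -> a_answer \notin l -> outputs st o -> outputs st' o.
Proof. by move=> [agree _] off_answer out i lt_i; rewrite agree // out. Qed.

Lemma outputs_size st (s : seq E) :
  outputs st (Some s) -> nats st a_answer 0 = (size s).+1.
Proof. by move=> ->. Qed.

Lemma outputs_index st (s : seq E) x :
  outputs st (Some s) -> x \in s -> nats st a_answer (index x s).+1 = rk x.
Proof.
move=> out xs; rewrite out /= ?(nth_map x) ?nth_index ?index_mem //.
by rewrite size_map ltnS index_mem.
Qed.

Definition answer_at (j : nexp) : nexp := NGet a_answer (NAdd j (NConst 1)).
Definition answer_size : nexp := NSub (NGet a_answer (NConst 0)) (NConst 1).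
Definition position : nexp := cell0 a_index.
Definition found : nexp := NSub (cell0 a_found) (NConst 1).

Lemma answer_size_eval st (s : seq E) :
  outputs st (Some s) -> neval st answer_size = size s.
Proof. by move=> out; rewrite /= (outputs_size out) subn1. Qed.

Lemma answer_at_eval st (s : seq E) (j : nexp) x :
  outputs st (Some s) -> x \in s -> neval st j = index x s ->
  neval st (answer_at j) = rk x.
Proof. by move=> out xs jE; rewrite /= jE addn1 (outputs_index out). Qed.

Definition row_set st a i : {set E} := query_set E (fun j => nats st a (i + j)).

Lemma row_set_other st a a' i j v :
  a' != a -> row_set (set_nat st a j v) a' i = row_set st a' i.
Proof.
by move=> neq_a; apply/setP => x;
  rewrite !inE /= /update (negbTE neq_a).
Qed.

Lemma row_set_mark st a i (e : E) :
  row_set (set_nat st a (i + rk e) 1) a i = e |: row_set st a i.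
Proof.
apply/setP => x; rewrite !inE /= /update eqxx eqn_add2l enum_rank_eq.
by case: (x == e).
Qed.

Definition fill_query (x : nexp) : cmd :=
  for_loop a_index (cell0 a_size) (NSet a_query position x).

Lemma fill_query_spec (x : nexp) st (v : nat -> nat) :
  nats st a_size 0 = #|E| ->
  (forall st', agree_off [:: a_index; a_query] st st' ->
     neval st' x = v (nats st' a_index 0)) ->
  halts (fill_query x) st (#|E| * 3 + 2) (fun st' =>
    agree_off [:: a_index; a_query] st st' /\
    query_set E (nats st' a_query) = query_set E v).
Proof.
move=> sizeE xE.
pose Inv i st' := forall e : E, rk e < i -> nats st' a_query (rk e) = v (rk e).
apply: halts_weaken (halts_for (l := [:: a_index; a_query]) (n := #|E|) (k := 1)
  (Inv := Inv) _ (agree_off_refl _ _) _ _ _ _) _ _ => //.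
- by move=> st' [agree _]; rewrite /= agree.
- move=> i st' lt_i agree idx inv; apply: halts_nset => //.
  rewrite xE // /= idx; split=> //; first exact: agree_off_set.
  move=> e; rewrite /= /update /= ltnS; case: eqP => [-> //|/eqP e_neq le_i].
  by rewrite inv // ltn_neqAle e_neq.
- by move=> st' [agree inv]; split=> //; apply/setP => e; rewrite !inE inv.
Qed.

Definition mark_answer (b : bexp) a (base : nexp) : cmd :=
  for_loop a_index answer_size
    (If b (NSet a (NAdd base (answer_at position)) (NConst 1)) Skip).

Lemma mark_answer_spec (b : bexp) a (base : nexp) st (s : seq E)
    (p : pred nat) i :
  a \notin [:: a_answer; a_index] -> outputs st (Some s) -> uniq s ->
  (forall st', agree_off [:: a_index; a] st st' -> neval st' base = i) ->
  (forall st', agree_off [:: a_index; a] st st' ->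
     beval st' b = p (nats st' a_index 0)) ->
  halts (mark_answer b a base) st (#|E| * 4 + 2) (fun st' =>
    [/\ agree_off [:: a_index; a] st st',
        row_set st' a i = row_set st a i :|: indexed s p &
        forall j, ~~ (i <= j < i + #|E|) -> nats st' a j = nats st a j]).
Proof.
move=> a_new out uniq_s baseE bE; set l := [:: a_index; a].
have [a_ans idx_a] : a_answer \notin l /\ a != a_index.
  by move: a_new; rewrite !inE [a_answer == a]eq_sym => /norP[/negbTE ->].
have outE st' : agree_off l st st' -> outputs st' (Some s).
  by move=> agree; apply: outputs_agree_off agree _ out.
pose Inv n st' :=
  row_set st' a i = row_set st a i :|: indexed s (fun k => (k < n) && p k) /\
  forall j, ~~ (i <= j < i + #|E|) -> nats st' a j = nats st a j.
apply: halts_weaken (halts_for (l := l) (n := size s) (k := 2) (Inv := Inv)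
  _ (agree_off_refl _ _) _ _ _ _) _ _ => //.
- by move=> st' agree; apply/answer_size_eval/outE.
- move=> n j st' [rowE offE]; split; first by rewrite row_set_other.
  by move=> k /offE; rewrite /= /update (negbTE idx_a).
- by split; rewrite ?indexed_ltn0 ?setU0.
- move=> n st' lt_n agree idx [rowE offE].
  have [y ys yE] := index_onto uniq_s lt_n.
  apply: halts_if; rewrite bE // idx.
  rewrite /Inv -yE indexed_ltnS // setUCA yE -rowE; case: ifP => _.
    have markE : neval st' (NAdd base (answer_at position)) = i + rk y.
      rewrite -(answer_at_eval (outE _ agree) ys (j := position)) /= ?baseE //.
      by rewrite idx.
    apply: halts_nset; rewrite // markE; split.
    + by apply: agree_off_set; rewrite ?inE ?eqxx ?orbT.
    + by rewrite /= /update [a_index == a]eq_sym (negbTE idx_a).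
    + split=> [|j off_row]; first by rewrite row_set_mark.
      rewrite /= /update eqxx ifN ?offE //; apply: contra off_row => /eqP ->.
      by rewrite leq_addr ltn_add2l ltn_ord.
  by apply: halts_skip => //; rewrite set0U.
- by rewrite leq_add2r leq_mul2r uniq_size_le_card ?orbT.
- by move=> st' [agree [rowE offE]]; rewrite rowE indexed_ltn_size.
Qed.

Definition search (bound : nexp) (eligible better : bexp) : cmd :=
  Seq (NSet a_found (NConst 0) (NConst 0))
    (for_loop a_index bound
       (If (BAnd eligible
              (BNot (BAnd (NLe (NConst 1) (cell0 a_found)) (BNot better))))
          (NSet a_found (NConst 0) (NAdd position (NConst 1)))
          Skip)).

Lemma search_spec (bound : nexp) (eligible better : bexp) st n (p : pred nat)
    (r : rel nat) :
  irreflexive r -> transitive r ->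
  (forall st', agree_off [:: a_index; a_found] st st' -> neval st' bound = n) ->
  (forall st', agree_off [:: a_index; a_found] st st' ->
     nats st' a_index 0 < n -> beval st' eligible = p (nats st' a_index 0)) ->
  (forall st', agree_off [:: a_index; a_found] st st' ->
     beval st' better = r (nats st' a_index 0) (nats st' a_found 0 - 1)) ->
  halts (search bound eligible better) st (n * 4 + 3) (fun st' =>
    agree_off [:: a_index; a_found] st st' /\
    optimal_index n p r (nats st' a_found 0)).
Proof.
move=> r_irr r_trans boundE eligibleE betterE; set l := [:: a_index; a_found].
rewrite [_ + 3]addnS; apply: halts_nset_seq => /=.
apply: (halts_for (l := l) (st0 := st) (k := 2)
  (Inv := fun i st' => optimal_index i p r (nats st' a_found 0))) => //.
  by apply: agree_off_set => //; apply: agree_off_refl.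
move=> i st' lt_i agree idx opt; apply: halts_if; rewrite [beval _ _]/=.
rewrite eligibleE ?idx // betterE // idx.
have := optimal_index_succ r_irr r_trans opt; case: ifP => _ opt'.
  by apply: halts_nset => //=; rewrite idx addn1; split=> //;
    apply: agree_off_set.
by apply: halts_skip.
Qed.

Lemma search_answer_spec (eligible better : bexp) st (s : seq E) (p : pred E)
    (r : rel nat) :
  irreflexive r -> transitive r -> outputs st (Some s) -> uniq s ->
  (forall st' x, agree_off [:: a_index; a_found] st st' -> x \in s ->
     nats st' a_index 0 = index x s -> beval st' eligible = p x) ->
  (forall st', agree_off [:: a_index; a_found] st st' ->
     beval st' better = r (nats st' a_index 0) (nats st' a_found 0 - 1)) ->
  halts (search answer_size eligible better) st (#|E| * 4 + 3) (fun st' =>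
    agree_off [:: a_index; a_found] st st' /\
    optimal_entry s p r (nats st' a_found 0)).
Proof.
move=> r_irr r_trans out uniq_s eligibleE betterE.
have pE x : x \in s -> nth false (map p s) (index x s) = p x.
  by move=> xs; rewrite (nth_map x) ?index_mem // nth_index.
apply: halts_weaken (search_spec (n := size s) (p := nth false (map p s))
  r_irr r_trans _ _ betterE) _ _ => [st' agree|st' agree lt_i||st' [agree]].
- by apply/answer_size_eval/(outputs_agree_off agree).
- have [x xs xE] := index_onto uniq_s lt_i.
  by rewrite (eligibleE st' x) // -xE pE.
- by rewrite leq_add2r leq_mul2r uniq_size_le_card ?orbT.
case: (nats st' a_found 0) => [|i] /= opt; split=> //.
  by move=> x xs; rewrite -pE // opt ?index_mem.
have [lt_i pi best] := opt; have [e es eE] := index_onto uniq_s lt_i.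
exists e; rewrite -pE // eE; split=> // x xs px.
by apply: best; rewrite ?index_mem // pE.
Qed.

Definition find_entering : cmd :=
  search answer_size
    (NLe (NGet a_left (answer_at position)) (NConst 0))
    (BNot (NLe found position)).

Lemma find_entering_spec st (s : seq E) :
  outputs st (Some s) -> uniq s ->
  halts find_entering st (#|E| * 4 + 3) (fun st' =>
    agree_off [:: a_index; a_found] st st' /\
    optimal_entry s (fun x => nats st a_left (rk x) == 0) ltn
      (nats st' a_found 0)).
Proof.
move=> out uniq_s; apply: search_answer_spec => //.
- exact: ltn_trans.
- move=> st' x agree xs idx; have out' := outputs_agree_off agree isT out.
  have := answer_at_eval out' xs (j := position) idx.
  by rewrite /= => ->; rewrite leqn0 agree.1.
- by move=> st' agree; rewrite /= ltnNge.
Qed.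

Definition find_min_due : cmd :=
  search (cell0 a_size) (NLe (NGet a_query position) (NConst 0))
    (BNot (RLe (RGet r_due found) (RGet r_due position))).

Lemma find_min_due_spec st :
  nats st a_size 0 = #|E| ->
  halts find_min_due st (#|E| * 4 + 3) (fun st' =>
    agree_off [:: a_index; a_found] st st' /\
    if nats st' a_found 0 is i.+1 then
      exists m : E, [/\ i = rk m, m \notin query_set E (nats st a_query) &
        forall x : E, x \notin query_set E (nats st a_query) ->
          (rls st r_due (rk m) <= rls st r_due (rk x))%R]
    else query_set E (nats st a_query) = setT).
Proof.
move=> sizeE; pose r i j := (rls st r_due i < rls st r_due j)%R.
apply: halts_weaken
  (search_spec (n := #|E|) (p := fun i => nats st a_query i == 0)
  (r := r) _ _ _ _ _) _ _ => //.
- by move=> i; rewrite /r ltxx.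
- by move=> i j k; apply: lt_trans.
- by move=> st' agree; rewrite /= agree.1.
- by move=> st' agree _; rewrite /= leqn0 agree.1.
- by move=> st' [_ rlsE]; rewrite /= rlsE -ltNge.
move=> st' [agree]; case: (nats st' a_found 0) => [|i] /= opt; split=> //.
  by apply/setP => x; rewrite !inE opt.
have [lt_i qi best] := opt; exists (enum_val (Ordinal lt_i)).
have rank_m : rk (enum_val (Ordinal lt_i)) = i by rewrite enum_valK.
rewrite inE negbK rank_m; split=> // x; rewrite inE negbK => qx.
by rewrite leNgt; apply: best.
Qed.

Variables (N : abstract_network E) (gamma : E -> R).
Hypothesis oracleO : membership_oracle N O.
Hypothesis gamma_ge0 : forall e, (0 <= gamma e)%R.
Implicit Type h : cut_history R E.

Record represents h st : Prop := Represents {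
  rep_size : nats st a_size 0 = #|E|;
  rep_rounds : nats st a_rounds 0 = rounds h;
  rep_clock : rls st r_clock 0 = clock h;
  rep_entered : forall e, nats st a_entered (rk e) = entered_at h e;
  rep_left : forall e, nats st a_left (rk e) = left_at h e;
  rep_gamma : forall e, rls st r_gamma (rk e) = gamma e;
  rep_due : forall e, rls st r_due (rk e) = due h e;
  rep_row : {in discovered h, forall e,
    nats st a_row (rk e) + #|E| <= nats st a_free 0};
  rep_access : {in discovered h, forall e,
    row_set st a_access (nats st a_row (rk e)) = access h e}
}.

Lemma represents_agree_off l h st st' :
  agree_off l st st' ->
  all (fun a => a \notin l)
    [:: a_size; a_entered; a_left; a_row; a_access; a_free; a_rounds] ->
  represents h st -> represents h st'.
Proof.
move=> [agree rlsE] /=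
  /and5P[off_size off_entered off_left off_row
    /and4P[off_access off_free off_rounds _]]
  rep.
have [sizeE roundsE clockE enteredE leftE gammaE dueE rowE accessE] := rep.
split; rewrite ?rlsE ?agree //.
- by move=> e; rewrite agree.
- by move=> e; rewrite agree.
- by move=> e e_old; rewrite !agree ?rowE.
- by move=> e e_old; rewrite -accessE //; apply/setP => x; rewrite !inE !agree.
Qed.

Definition tracks h st : Prop :=
  [/\ represents h st, query_set E (nats st a_query) = ~: frontier h &
      forall j, nats st a_free 0 <= j -> nats st a_access j = 0].

Lemma tracks_agree_off l h st st' :
  agree_off l st st' ->
  all (fun a => a \notin l)
    [:: a_size; a_query; a_entered; a_left;
        a_row; a_access; a_free; a_rounds] ->
  tracks h st -> tracks h st'.
Proof.
move=> agree /= off [rep queryE fresh].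
have /and5P[off_size off_query off_entered off_left] := off.
move=> /and5P[off_row off_access off_free off_rounds _]; split.
- apply: represents_agree_off agree _ rep;
    rewrite /= off_size off_entered off_left.
  by rewrite off_row off_access off_free off_rounds.
- by rewrite -queryE; apply/setP => x; rewrite !inE agree.1.
- by move=> j; rewrite !agree.1 //; apply: fresh.
Qed.

Definition leave_frontier : cmd :=
  Seq (NSet a_left found (NAdd (cell0 a_rounds) (NConst 1)))
    (Seq (NSet a_query found (NConst 1))
      (Seq (RSet r_clock (NConst 0) (RGet r_due found))
        (NSet a_rounds (NConst 0) (NAdd (cell0 a_rounds) (NConst 1))))).

Lemma leave_frontier_spec h st m :
  tracks h st -> nats st a_found 0 = (rk m).+1 ->
  halts leave_frontier st 4 (fun st' =>
    tracks (leave h m) st' /\ nats st' a_found 0 = nats st a_found 0).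
Proof.
move=> [rep queryE fresh] foundE.
have posE : nats st a_found 0 - 1 = rk m by rewrite foundE subn1.
do 2 apply: halts_nset_seq; apply: halts_rset_seq; apply: halts_nset => //=.
rewrite /= /update /= posE; split=> //.
have [sizeE roundsE clockE enteredE leftE gammaE dueE rowE accessE] := rep.
split=> //.
- split=> //= [||e]; rewrite /update /= ?roundsE ?dueE ?addn1 //.
  by rewrite enum_rank_eq; case: eqP.
- rewrite frontier_leave setCD -queryE; apply/setP => x.
  by rewrite !inE /= /update /= enum_rank_eq orbC; case: (x == m).
Qed.

Definition store_access : cmd :=
  mark_answer (NLe position found) a_access (cell0 a_free).

Definition enter_frontier : cmd :=
  Seq store_access
    (Seq (NSet a_entered (answer_at found) (NAdd (cell0 a_rounds) (NConst 1)))
      (Seq (NSet a_query (answer_at found) (NConst 0))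
        (Seq (RSet r_due (answer_at found)
               (RAdd (RGet r_clock (NConst 0))
                 (RGet r_gamma (answer_at found))))
          (Seq (NSet a_row (answer_at found) (cell0 a_free))
            (NSet a_free (NConst 0) (NAdd (cell0 a_free) (cell0 a_size))))))).

Lemma store_access_spec h st (s : seq E) e :
  tracks h st -> outputs st (Some s) -> uniq s ->
  nats st a_found 0 = (index e s).+1 ->
  halts store_access st (#|E| * 4 + 2) (fun st' =>
    [/\ agree_off [:: a_index; a_access] st st', represents h st',
        row_set st' a_access (nats st a_free 0) = prefix_to s e &
        forall j, nats st a_free 0 + #|E| <= j -> nats st' a_access j = 0]).
Proof.
move=> [rep _ fresh] out uniq_s foundE; set free := nats st a_free 0.
apply: halts_weaken (mark_answer_spec (i := free) (p := fun i => i <= index e s)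
  _ out uniq_s _ _) _ _ => //.
- by move=> st' agree; rewrite /= agree.1.
- by move=> st' agree; rewrite /= (agree.1 a_found) // foundE subn1.
move=> st' [agree rowE offE]; split=> //.
- have [sizeE roundsE clockE enteredE leftE gammaE dueE row_le accessE] := rep.
  split; rewrite ?agree.2 ?agree.1 //.
  + by move=> x; rewrite agree.1.
  + by move=> x; rewrite agree.1.
  + by move=> x x_old; rewrite !agree.1 // row_le.
  + move=> x x_old; rewrite -accessE //; apply/setP => y;
      rewrite !inE (agree.1 a_row) // offE //.
    rewrite negb_and -ltnNge (leq_trans _ (row_le x x_old)) //.
    by rewrite ltn_add2l ltn_ord.
- rewrite rowE (_ : row_set _ _ _ = set0) ?set0U //.
  by apply/setP => x; rewrite !inE fresh // leq_addr.
- by move=> j le_j; rewrite offE ?fresh //; move: le_j; rewrite -/free; lia.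
Qed.

Lemma enter_frontier_spec h st (s : seq E) e :
  cut_packing N gamma h -> tracks h st -> outputs st (Some s) -> uniq s ->
  e \in s -> e \notin discovered h -> nats st a_found 0 = (index e s).+1 ->
  halts enter_frontier st (#|E| * 4 + 7) (fun st' =>
    tracks (enter gamma h e (prefix_to s e)) st' /\
    nats st' a_found 0 = nats st a_found 0).
Proof.
move=> pack_h tracks_st out uniq_s es e_new foundE.
apply: (halts_seq (k1 := #|E| * 4 + 2) (k2 := 5)); last by rewrite -addnA.
apply: halts_weaken (store_access_spec tracks_st out uniq_s foundE) (leqnn _) _.
move=> st1 [agree rep prefixE blank]; have [_ queryE _] := tracks_st.
have posE : nats st1 a_answer (nats st1 a_found 0 - 1 + 1) = rk e.
  by rewrite !agree.1 // foundE addn1 subn1 (outputs_index out).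
have freeE : nats st1 a_free 0 = nats st a_free 0 by rewrite agree.1.
do 2 apply: halts_nset_seq; apply: halts_rset_seq; apply: halts_nset_seq.
apply: halts_nset => //=; rewrite /= /update /= posE; split;
  last exact: agree.1.
have [sizeE roundsE clockE enteredE leftE gammaE dueE row_le accessE] := rep.
split=> //=.
- split=> //= [x|x|x|x]; rewrite /update /= ?enum_rank_eq.
  + by rewrite roundsE addn1; case: eqP.
  + by rewrite clockE gammaE; case: eqP.
  + rewrite discovered_enter in_setU1 sizeE; case: eqP => //= _ x_old.
    exact: leq_trans (row_le x x_old) (leq_addr _ _).
  + rewrite discovered_enter in_setU1; case: eqP => [_ _|_ x_old].
      by rewrite freeE -prefixE.
    exact: accessE.
- rewrite (frontier_enter _ pack_h e_new) setCU -queryE; apply/setP => x.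
  by rewrite !inE /= /update /= enum_rank_eq agree.1 //; case: (x == e).
- by rewrite /update /= sizeE freeE.
Qed.

Definition packing_step : cmd :=
  Seq (Query a_query a_answer)
    (If (NLe (NConst 1) (NGet a_answer (NConst 0)))
       (Seq find_entering
         (If (NLe (NConst 1) (cell0 a_found)) enter_frontier Skip))
       (Seq find_min_due
         (If (NLe (NConst 1) (cell0 a_found)) leave_frontier Skip))).

Definition packing_finished h st : Prop :=
  represents h st /\
  exists2 o, outputs st o &
    if o is Some s then listed_path N s /\ [set x in s] \subset exhausted h
    else paths N = set0.

Definition packing_state n st : Prop :=
  exists2 h, cut_packing N gamma h &
    if nats st a_found 0 == 0 then packing_finished h st
    else tracks h st /\ #|E|.*2 < n + #|discovered h| + rounds h.

Lemma path_found_spec n h st (s : seq E) :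
  cut_packing N gamma h -> tracks h st ->
  #|E|.*2 < n.+1 + #|discovered h| + rounds h ->
  outputs st (Some s) -> listed_path N s ->
  [set x in s] \subset ~: frontier h ->
  halts (Seq find_entering
    (If (NLe (NConst 1) (cell0 a_found)) enter_frontier Skip))
    st (#|E| * 8 + 11) (packing_state n).
Proof.
move=> pack_h tracks_st progress out list_s s_off; have [_ uniq_s _] := list_s.
apply: (halts_seq (k1 := #|E| * 4 + 3) (k2 := (#|E| * 4 + 7).+1)); last by lia.
apply: halts_weaken (find_entering_spec out uniq_s) (leqnn _) _ => st1 [agree].
have {}tracks_st := tracks_agree_off agree isT tracks_st.
have {}out := outputs_agree_off agree isT out.
have leftE x : (nats st a_left (rk x) == 0) = (x \notin exhausted h).
  by have [rep _ _] := tracks_st;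
    rewrite -(agree.1 a_left) // (rep_left rep) inE eqn0Ngt.
case foundE: (nats st1 a_found 0) => [|i] /= opt; apply: halts_if => /=;
  rewrite foundE /=.
  apply: halts_skip; first by lia.
  exists h => //; rewrite foundE; have [rep _ _] := tracks_st; split=> //.
  exists (Some s) => //; split=> //; apply/subsetP => x; rewrite inE => xs.
  by have := opt x xs; rewrite leftE negbK.
have [e [es iE e_kept before_e]] := opt; rewrite leftE in e_kept.
have e_new : e \notin discovered h.
  have e_in : e \in [set x in s] by rewrite inE.
  by have := subsetP s_off e e_in; rewrite in_setC in_setD e_kept.
apply: halts_weaken
  (enter_frontier_spec pack_h tracks_st out uniq_s es e_new _) _ _ => //.
  by rewrite foundE iE.
move=> st2 [tracks_st2 found2].
exists (enter gamma h e (prefix_to s e)).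
  apply: cut_packing_enter => // x xs lt_x.
  by have := before_e x xs; rewrite leftE iE => /contraLR; apply.
rewrite found2 foundE; split=> //.
by rewrite discovered_enter cardsU1 e_new addnCA.
Qed.

Lemma cut_found_spec n h st :
  cut_packing N gamma h -> tracks h st ->
  #|E|.*2 < n.+1 + #|discovered h| + rounds h ->
  outputs st (None : option (seq E)) ->
  (forall P, P \in paths N -> P :&: frontier h != set0) ->
  halts (Seq find_min_due
    (If (NLe (NConst 1) (cell0 a_found)) leave_frontier Skip))
    st (#|E| * 4 + 8) (packing_state n).
Proof.
move=> pack_h tracks_st progress out frontier_meets.
have [rep queryE _] := tracks_st.
apply: (halts_seq (k1 := #|E| * 4 + 3) (k2 := 5)); last by rewrite -addnA.
apply: halts_weaken (find_min_due_spec (rep_size rep)) (leqnn _) _ =>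
  st1 [agree].
have {}tracks_st := tracks_agree_off agree isT tracks_st.
have [{}rep _ _] := tracks_st.
rewrite queryE.
case foundE: (nats st1 a_found 0) => [|i] opt; apply: halts_if => /=;
  rewrite foundE /=.
  apply: halts_skip => //; exists h => //; rewrite foundE; split=> //.
  exists None; first exact: outputs_agree_off agree _ out.
  apply/setP => P; rewrite inE; apply/negP => /frontier_meets.
  by rewrite -[frontier h]setCK opt setCT setI0 eqxx.
have [m [iE]] := opt; rewrite inE negbK => m_front min_m.
apply: halts_weaken (leave_frontier_spec (m := m) tracks_st _) _ _ => //.
  by rewrite foundE iE.
move=> st2 [tracks_st2 found2]; exists (leave h m).
  apply: cut_packing_leave => // x x_front.
  by rewrite -!(rep_due rep) agree.2; apply: min_m; rewrite inE negbK.
by rewrite found2 foundE; split; rewrite //= addnS.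
Qed.

Lemma packing_step_spec n st :
  packing_state n.+1 st -> nats st a_found 0 != 0 ->
  halts packing_step st (T + (#|E| * 8 + 12)) (packing_state n).
Proof.
move=> [h pack_h] + found_neq0;
  rewrite (negbTE found_neq0) => -[tracks_st progress].
apply: halts_seq (leqnn _); apply: halts_query => st1 agree out.
have {}tracks_st := tracks_agree_off agree isT tracks_st.
have [_ queryE _] := tracks_st.
have query1E : query_set E (nats st a_query) = ~: frontier h.
  by rewrite -queryE; apply/setP => x; rewrite !inE agree.1.
rewrite query1E in out; rewrite addnS; apply: halts_if => /=.
case O_F: (O _) out => [s|] out.
  have [list_s s_off] := oracle_some oracleO O_F.
  by rewrite (outputs_size out); apply: path_found_spec list_s s_off.
rewrite out //.
apply: halts_weaken (cut_found_spec pack_h tracks_st progress out _) _ _ => //.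
  by move=> P; apply: oracle_none O_F.
by rewrite leq_add // leq_mul2l orbT.
Qed.

Definition packing_loop : cmd :=
  While (NLe (NConst 1) (cell0 a_found)) packing_step.

Lemma packing_loop_spec st :
  packing_state #|E|.*2.+1 st ->
  halts packing_loop st (#|E|.*2.+1 * (T + (#|E| * 8 + 12)).+1).+1
    (fun st' => exists2 h, cut_packing N gamma h & packing_finished h st').
Proof.
move=> state_st; apply: halts_weaken (halts_while (Inv := packing_state)
  (k := T + (#|E| * 8 + 12)) _ _ state_st) _ _ => //.
- move=> st' [h pack_h]; case: eqP => [found0 _|_ [_]];
    first by rewrite /= found0.
  rewrite add0n (rounds_exhausted pack_h) ltnNge => /negP[].
  by rewrite -addnn leq_add ?max_card.
- by move=> n st' state_st' /=; rewrite lt0n; apply: packing_step_spec.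
- move=> st' [stop [n [h pack_h]]]; move: stop; rewrite /= lt0n negbK => ->.
  by exists h.
Qed.

Definition start_packing : cmd :=
  Seq (NSet a_found (NConst 0) (NConst 1)) (fill_query (NConst 1)).

Lemma start_packing_spec :
  halts start_packing (initial_state gamma) (#|E| * 3 + 3)
    (packing_state #|E|.*2.+1).
Proof.
rewrite [_ + 3]addnS; apply: halts_nset_seq => /=.
apply: halts_weaken (fill_query_spec (v := fun=> 1) _ _) (leqnn _) _ => //
  st [agree queryE].
exists (empty_history R E); first exact: cut_packing_empty.
rewrite agree.1 //=; split; last by rewrite -addnA leq_addr.
split=> [||j _]; last by rewrite agree.1.
- split; rewrite ?agree.2 ?agree.1 //.
  + by move=> e; rewrite agree.1.
  + by move=> e; rewrite agree.1.
  + by move=> e; rewrite /= (nth_map e) -?cardE ?nth_enum_rank.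
  + by move=> e; rewrite discovered_empty inE.
  + by move=> e; rewrite discovered_empty inE.
- rewrite queryE /frontier discovered_empty set0D setC0.
  by apply/setP => e; rewrite !inE.
Qed.

Definition find_last_in_cut : cmd :=
  search answer_size
    (BAnd (NLe (NGet a_entered (answer_at position)) (cell0 a_cut))
       (NLe (cell0 a_cut) (NGet a_left (answer_at position))))
    (BNot (NLe position found)).

Lemma find_last_in_cut_spec h st (s : seq E) :
  cut_packing N gamma h -> represents h st -> outputs st (Some s) ->
  listed_path N s -> [set x in s] \subset exhausted h ->
  0 < nats st a_cut 0 <= rounds h ->
  halts find_last_in_cut st (#|E| * 4 + 3) (fun st' =>
    agree_off [:: a_index; a_found] st st' /\
    exists e, [/\ e \in s, nats st' a_found 0 = (index e s).+1,
      e \in cut h (nats st a_cut 0) &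
      {in s, forall x, x \in cut h (nats st a_cut 0) ->
         index x s <= index e s}]).
Proof.
move=> pack_h rep out [path_s uniq_s _] s_exh cut_bounds.
set i := nats st a_cut 0.
have in_cutE x : x \in s ->
    (nats st a_entered (rk x) <= i <= nats st a_left (rk x)) = (x \in cut h i).
  move=> xs; rewrite (rep_entered rep) (rep_left rep).
  rewrite (mem_cut_exhausted _ pack_h) //.
  by apply: (subsetP s_exh); rewrite inE.
apply: halts_weaken (search_answer_spec (r := fun j k => k < j)
  (p := fun x => nats st a_entered (rk x) <= i <= nats st a_left (rk x))
  _ _ out uniq_s _ _) (leqnn _) _ =>
    [j|j k l lt_jk lt_lj|st' x agree xs idx|st' agree|].
- exact: ltnn.
- exact: ltn_trans lt_jk.
- have out' := outputs_agree_off agree isT out.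
  have := answer_at_eval out' xs (j := position) idx.
  by rewrite /= => ->; rewrite !agree.1.
- by rewrite /= ltnNge.
move=> st' [agree]; case: (nats st' a_found 0) => [|j] /= opt; split=> //.
  have [x /setIP[]] := set0Pn _ (cut_meets pack_h cut_bounds path_s).
  by rewrite inE => xs; rewrite -/i -in_cutE // (negbTE (opt x xs)).
have [e [es jE e_cut last_e]] := opt; exists e; rewrite jE -in_cutE //;
  split=> //.
by move=> x xs; rewrite -in_cutE // => /(last_e x xs); rewrite jE -leqNgt.
Qed.

Definition query_reroute : cmd :=
  Seq (fill_query
    (NGet a_access (NAdd (NGet a_row (answer_at found)) position)))
    (mark_answer (NLe found position) a_query (NConst 0)).

Lemma query_reroute_spec h st (s : seq E) e :
  represents h st -> outputs st (Some s) -> uniq s -> e \in s ->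
  e \in discovered h ->
  nats st a_found 0 = (index e s).+1 ->
  halts query_reroute st (#|E| * 7 + 4) (fun st' =>
    agree_off [:: a_index; a_query] st st' /\
    query_set E (nats st' a_query) = access h e :|: suffix_from s e).
Proof.
move=> rep out uniq_s es e_old foundE.
have answerE : nats st a_answer (nats st a_found 0 - 1 + 1) = rk e.
  by rewrite foundE subn1 addn1 (outputs_index out).
apply: (halts_seq (k1 := #|E| * 3 + 2) (k2 := #|E| * 4 + 2)); last by lia.
apply: halts_weaken (fill_query_spec
  (v := fun j => nats st a_access (nats st a_row (rk e) + j)) (rep_size rep) _)
  (leqnn _) _ => [st' agree|st1 [agree queryE]].
  by rewrite /= -answerE (agree.1 a_row) // (agree.1 a_answer) //
    (agree.1 a_found) // agree.1.
apply: halts_weaken (mark_answer_spec (i := 0) (p := fun i => index e s <= i)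
  _ (outputs_agree_off agree _ out) uniq_s _ _) _ _ => //
  [st2 agree2|st2 [agree2 rowE _]].
  by rewrite /= (agree2.1 a_found) // agree.1 // foundE subn1.
split; first exact: agree_off_trans agree agree2.
rewrite -[query_set _ _]/(row_set st2 a_query 0) rowE -(rep_access rep e_old).
by congr (_ :|: _); apply: queryE.
Qed.

Definition rerouting_step : cmd :=
  Seq find_last_in_cut
    (Seq query_reroute
      (Seq (Query a_query a_answer)
        (NSet a_cut (NConst 0) (NSub (cell0 a_cut) (NConst 1))))).

Definition rerouting_state h n st : Prop :=
  [/\ represents h st, nats st a_cut 0 = n, n <= rounds h &
      exists s, [/\ outputs st (Some s), listed_path N s,
        [set x in s] \subset exhausted h &
        crosses_once_after h n [set x in s]]].

Lemma rerouting_step_spec h n st :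
  cut_packing N gamma h -> rerouting_state h n.+1 st ->
  halts rerouting_step st (T + (#|E| * 11 + 8)) (rerouting_state h n).
Proof.
move=> pack_h [rep cutE le_n [s [out list_s s_exh s_once]]].
have [_ uniq_s _] := list_s.
apply: (halts_seq (k1 := #|E| * 4 + 3) (k2 := #|E| * 7 + 4 + (T + 1)));
  last by lia.
apply: halts_weaken (find_last_in_cut_spec pack_h rep out list_s s_exh _)
  (leqnn _) _.
  by rewrite cutE.
rewrite cutE => st1 [agree [e [es foundE e_cut last_e]]].
have {}rep := represents_agree_off agree isT rep.
have {}out := outputs_agree_off agree isT out.
have /setIdP[e_old _] := e_cut.
apply: halts_seq (leqnn _).
apply: halts_weaken (query_reroute_spec rep out uniq_s es e_old foundE)
  (leqnn _) _.
move=> st2 [agree2 queryE]; have {}rep := represents_agree_off agree2 isT rep.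
apply: halts_seq (leqnn _); apply: halts_query => st3 agree3 out3.
have {}rep := represents_agree_off agree3 isT rep.
have [Q pathQ subQ] := access_switch pack_h e_old list_s es.
case O_F: (O _) out3 => [u|] out3; last first.
  have := oracleO (query_set E (nats st2 a_query)); rewrite O_F => /(_ Q pathQ).
  by rewrite queryE subQ.
have [list_u sub_u] := oracle_some oracleO O_F; rewrite queryE in sub_u.
apply: halts_nset => //; set st4 := set_nat _ _ _ _.
have agree4 : agree_off [:: a_cut] st3 st4 by apply: agree_off_set1.
split.
- exact: represents_agree_off agree4 isT rep.
- by rewrite /= /update /= !(agree3.1, agree2.1, agree.1) // cutE subn1.
- exact: ltnW.
exists u; split=> //.
- exact: reroute_exhausted pack_h es e_cut s_exh sub_u.
- exact: reroute_crosses_once pack_h es e_cut s_exh last_e s_once sub_u.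
Qed.

Definition rerouting : cmd :=
  Seq (NSet a_cut (NConst 0) (cell0 a_rounds))
    (While (NLe (NConst 1) (cell0 a_cut)) rerouting_step).

Lemma rerouting_spec h st (s : seq E) :
  cut_packing N gamma h -> represents h st -> outputs st (Some s) ->
  listed_path N s -> [set x in s] \subset exhausted h ->
  halts rerouting st (#|E| * (T + (#|E| * 11 + 8)).+1).+2
    (fun st' => exists2 o, outputs st' o & solves_min_path N gamma o).
Proof.
move=> pack_h rep out list_s s_exh; apply: halts_nset_seq => /=;
  rewrite (rep_rounds rep).
set st0 := set_nat _ _ _ _.
have agree : agree_off [:: a_cut] st st0 by apply: agree_off_set1.
have state0 : rerouting_state h (rounds h) st0.
  split=> //; first exact: represents_agree_off agree isT rep.
  exists s; split=> //.
  by move=> j /andP[lt_j le_j]; rewrite leqNgt lt_j in le_j.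
apply: halts_weaken (halts_while (Inv := rerouting_state h)
  (k := T + (#|E| * 11 + 8)) _ _ state0) _ _.
- by move=> st' [_ cut0 _ _]; rewrite /= cut0.
- by move=> n st' state_st' _; apply: rerouting_step_spec.
- by rewrite ltnS leq_mul2r (rounds_exhausted pack_h) max_card orbT.
move=> st' [stop [n [_ cutE _ [u [out_u [path_u uniq_u _] u_exh u_once]]]]].
have n0 : n = 0 by apply/eqP; move: stop; rewrite /= cutE lt0n negbK.
rewrite n0 in u_once; exists (Some u) => //; exists [set x in u].
  split=> // Q pathQ;
    exact: crosses_once_optimal pack_h path_u u_exh u_once pathQ.
by split=> // x; rewrite inE.
Qed.

Definition min_path_program : cmd :=
  Seq start_packing
    (Seq packing_loop
      (If (NLe (NConst 1) (NGet a_answer (NConst 0))) rerouting Skip)).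

Definition program_time n : nat :=
  n * 3 + 3 + ((n.*2.+1 * (T + (n * 8 + 12)).+1).+1 +
    (n * (T + (n * 11 + 8)).+1).+3).

Lemma program_time_quadratic n :
  0 < n -> 0 < T -> program_time n <= 200 * n ^ 2 * T.
Proof. by rewrite /program_time -mulnn; nia. Qed.

Lemma min_path_program_spec :
  halts min_path_program (initial_state gamma) (program_time #|E|)
    (fun st => exists2 o, outputs st o & solves_min_path N gamma o).
Proof.
apply: halts_seq (leqnn _);
  apply: halts_weaken start_packing_spec (leqnn _) _ => st1 state1.
apply: halts_seq (leqnn _);
  apply: halts_weaken (packing_loop_spec state1) (leqnn _) _.
move=> st2 [h pack_h [rep [[s|] out fin]]]; apply: halts_if => /=.
  by rewrite (outputs_size out); case: fin; apply: rerouting_spec.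
by rewrite out //; apply: halts_skip => //; exists None.
Qed.

End Machine.

Theorem theorem5 (R : realType) :
  exists (prog : cmd) (C : nat),
    forall (E : finType) (N : abstract_network E)
      (O : {set E} -> option (seq E)) (T : nat) (gamma : E -> R),
      membership_oracle N O ->
      (0 < T)%N ->
      (forall e, (0 <= gamma e)%R) ->
      exists (st : state R) (t : nat) (o : option (seq E)),
        [/\ exec O T prog (initial_state gamma) st t,
            outputs st o,
            solves_min_path N gamma o
          & (0 < #|E|)%N -> (t <= C * #|E| ^ 2 * T)%N].
Proof.
exists min_path_program, 200 => E N O T gamma oracleO T_gt0 gamma_ge0.
have [st [t [run le_t [o out sol]]]] :=
  min_path_program_spec T oracleO gamma_ge0.
exists st, t, o; split=> // E_gt0.
exact: leq_trans le_t (program_time_quadratic E_gt0 T_gt0).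
Qed.
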